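(* Let $G_S$ be a self-loop graph of order $N$ with $\sigma=|S|\ge 1$ and loop vector $s\in\mathbb{R}^N$, let $\widetilde G=(\widetilde V,\widetilde E)$ be its Açıkmeşe lift, and let $T$ be the involution matrix, with $(\mathbb{R}^{\widetilde V})^{+}=\ker(T-I)$ and $(\mathbb{R}^{\widetilde V})^{-}=\ker(T+I)$. (i) With respect to $\mathbb{R}^{\widetilde V}=\mathbb{R}^N\oplus\mathbb{R}\oplus\mathbb{R}^N$ (lower copy, middle vertex, upper copy), define $$U_-=\begin{pmatrix}\frac{1}{\sqrt2}I_N\\ 0_{1\times N}\\ -\frac1{\sqrt2}I_N\end{pmatrix}\in\mathbb{R}^{(2N+1)\times N},\qquad U_+=\begin{pmatrix}0_{N\times 1}&\frac1{\sqrt2}I_N\\ 1&0_{1\times N}\\ 0_{N\times1}&\frac1{\sqrt2}I_N\end{pmatrix}\in\mathbb{R}^{(2N+1)\times(N+1)}.$$ Then $U=(U_-,U_+)$ is an orthogonal matrix, $U^\top U=I_{2N+1}$. Furthermore, the columns of $U_-$ (resp. $U_+$) form an orthonormal basis of $(\mathbb{R}^{\widetilde V})^-$ (resp. $(\mathbb{R}^{\widetilde V})^+$). (ii) Both $(\mathbb{R}^{\widetilde V})^-$ and $(\mathbb{R}^{\widetilde V})^+$ are invariant subspaces of the Laplacian $\mathcal{L}(\widetilde G)$. Moreover, the restriction of $\mathcal{L}(\widetilde G)$ to $(\mathbb{R}^{\widetilde V})^-$ is orthogonally equivalent to $\mathcal{L}(G_S)$, and the restriction of $\mathcal{L}(\widetilde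 G)$ to $(\mathbb{R}^{\widetilde V})^+$ is orthogonally equivalent to the $(N+1)\times(N+1)$ symmetric matrix $$M_{sym}=\begin{pmatrix}2\sigma&-\sqrt2\,s^\top\\ -\sqrt2\,s&\mathcal{L}(G_S)\end{pmatrix},$$ in which $\mathcal{L}(G_S)$ is an $N\times N$ principal submatrix.
   Context: Let $G$ be a finite undirected simple graph with vertex set $V=\{1,\dots,N\}$ (possibly disconnected), and $S\subseteq V$. The self-loop graph $G_S$ is obtained from $G$ by attaching one loop at every vertex of $S$; $\sigma=|S|$. The loop vector $s\in\mathbb{R}^N$ is the indicator vector of $S$. $\mathcal{L}(G)=D(G)-A(G)$ is the ordinary Laplacian (degree matrix minus adjacency matrix) and $\mathcal{L}(G_S):=\mathcal{L}(G)+\mathrm{diag}(s)$. For $\sigma\ge1$, the Açıkmeşe lift $\widetilde G=(\widetilde V,\widetilde E)$ of $G_S$ is the simple graph on $\widetilde V=\{1,\dots,2N+1\}$ such that: for each edge $\{i,j\}$ of $G$, both $\{i,j\}$ and $\{i+N+1,j+N+1\}$ are edges of $\widetilde G$; for each $i\in S$, both $\{i,N+1\}$ and $\{N+1,i+N+1\}$ are edges; there are no other edges. The vertices $1,\dots,N$ form the lower copy, $N+1$ is the middle vertex, and $N+2,\dots,2N+1$ form the upper copy. $\mathcal{L}(\widetilde G)$ is the ordinary Laplacian of $\widetilde G$. The involution matrix $T\in\mathbb{R}^{(2N+1)\times(2N+1)}$ is the permutation matrix of the map swapping $i\leftrightarrow i+N+1$ ($1\le i\le N$) and fixing $N+1$,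 i.e. $T(x_L,\alpha,x_U)=(x_U,\alpha,x_L)$ for $x_L,x_U\in\mathbb{R}^N$, $\alpha\in\mathbb{R}$. An operator restricted to an invariant subspace $W$ is orthogonally equivalent to a symmetric matrix $M$ if there is an orthonormal basis of $W$ in which the restricted operator has matrix $M$. *)

(* Defs.v *)
From HB Require Import structures.
From mathcomp Require Import all_boot all_order all_algebra all_fingroup.

Set Implicit Arguments.
Unset Strict Implicit.
Unset Printing Implicit Defensive.

Import Order.TTheory GRing.Theory Num.Theory.
Local Open Scope ring_scope.

Record sgraph (n : nat) := SGraph {
  edge :> rel 'I_n;
  edge_sym : symmetric edge;
  edge_irr : irreflexive edge
}.

Section Laplacian.
Variables (R : pzRingType) (n : nat) (G : sgraph n).

Definition degree_mx : 'M[R]_n := diag_mx (\row_i #|[set j | edge G i j]|%:R).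
Definition adjacency_mx : 'M[R]_n := \matrix_(i, j) (edge G i j)%:R.
Definition laplacian : 'M[R]_n := degree_mx - adjacency_mx.

Definition loop_vec (S : {set 'I_n}) : 'cV[R]_n := \col_i (i \in S)%:R.

(* The Laplacian of the self-loop graph G_S, a loop contributing 1. *)
Definition loop_laplacian (S : {set 'I_n}) : 'M[R]_n :=
  laplacian + diag_mx (loop_vec S)^T.

End Laplacian.

(* The 2N+1 vertices are typed 'I_(N + (1 + N)), so that matrices over them
   split into blocks; counting from 0, lower i, middle and upper i have values
   i, N and i + N + 1. *)
Section Lift.
Variable N : nat.

Definition lower (i : 'I_N) : 'I_(N + (1 + N)) := lshift (1 + N) i.
Definition middle : 'I_(N + (1 + N)) := rshift N (lshift N ord0).
Definition upper (i : 'I_N) : 'I_(N + (1 + N)) := rshift N (rshift 1 i).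

Lemma lower_inj : injective lower. Proof. exact: lshift_inj. Qed.
Lemma upper_inj : injective upper.
Proof. by move=> i j /rshift_inj/rshift_inj. Qed.
Lemma lower_neq_middle i : lower i != middle.
Proof. by rewrite eq_lrshift. Qed.
Lemma middle_neq_upper i : middle != upper i.
Proof. by rewrite (inj_eq (@rshift_inj _ _)) eq_lrshift. Qed.

Variables (G : sgraph N) (S : {set 'I_N}).

Definition lift_edge (u v : 'I_(N + (1 + N))) : bool :=
  [exists i, exists j, edge G i j &&
     (([set u; v] == [set lower i; lower j])
      || ([set u; v] == [set upper i; upper j]))]
  || [exists i in S, ([set u; v] == [set lower i; middle])
                     || ([set u; v] == [set middle; upper i])].

Lemma lift_edge_sym : symmetric lift_edge.
Proof. by move=> u v; rewrite /lift_edge (setUC [set u]). Qed.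

Lemma lift_edge_irr : irreflexive lift_edge.
Proof.
have eq1 (u a b : 'I_(N + (1 + N))) : [set u; u] == [set a; b] -> a = b.
  rewrite setUid => /eqP/setP e; move: (e a) (e b); rewrite !inE !eqxx orbT.
  by move=> /eqP -> /eqP ->.
move=> u; apply/negP => /orP[/existsP[i /existsP[j /andP[eij]]]|/existsP[i]].
  by case/orP=> /eq1 => [/lower_inj|/upper_inj] eq_ij;
    rewrite eq_ij edge_irr in eij.
case/andP=> _ /orP[] /eq1 /eqP; first by rewrite (negPf (lower_neq_middle i)).
by rewrite (negPf (middle_neq_upper i)).
Qed.

Definition acikmese_lift : sgraph (N + (1 + N)) :=
  SGraph lift_edge_sym lift_edge_irr.

End Lift.

Section Involution.
Variables (R : pzRingType) (N : nat).

Definition lift_swap (u : 'I_(N + (1 + N))) : 'I_(N + (1 + N)) :=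
  match split u with
  | inl i => upper i
  | inr w => match split w with
             | inl _ => middle N
             | inr i => lower i
             end
  end.

Lemma lift_swap_lower i : lift_swap (lower i) = upper i.
Proof. by rewrite /lift_swap (unsplitK (inl i)). Qed.
Lemma lift_swap_middle : lift_swap (middle N) = middle N.
Proof.
by rewrite /lift_swap (unsplitK (inr (lshift N ord0))) (unsplitK (inl ord0)).
Qed.
Lemma lift_swap_upper i : lift_swap (upper i) = lower i.
Proof.
by rewrite /lift_swap (unsplitK (inr (rshift 1 i))) (unsplitK (inr i)).
Qed.

Lemma lift_swapK : involutive lift_swap.
Proof.
move=> u; case: (split_ordP u) => [i|w] ->.
  by rewrite -/(lower i) lift_swap_lower lift_swap_upper.
case: (split_ordP w) => [k|i] ->; last first.
  by rewrite -/(upper i) lift_swap_upper lift_swap_lower.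
by rewrite (ord1 k) -/(middle N) !lift_swap_middle.
Qed.

Definition involution_mx : 'M[R]_(N + (1 + N)) :=
  perm_mx (perm (inv_inj lift_swapK)).

Lemma involution_mxE (xL xU : 'cV[R]_N) (a : 'cV[R]_1) :
  involution_mx *m col_mx xL (col_mx a xU) = col_mx xU (col_mx a xL).
Proof.
rewrite -row_permE; apply/colP => u; rewrite mxE permE.
case: (split_ordP u) => [i|w] ->.
  by rewrite -/(lower i) lift_swap_lower /lower /upper !(col_mxEu, col_mxEd).
case: (split_ordP w) => [k|i] ->; last first.
  by rewrite -/(upper i) lift_swap_upper /lower /upper !(col_mxEu, col_mxEd).
by rewrite (ord1 k) -/(middle N) lift_swap_middle /middle !(col_mxEu, col_mxEd).
Qed.

End Involution.

Section Operators.
Variables (R : fieldType) (n : nat).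
Implicit Types (A : 'M[R]_n) (W : {vspace 'cV[R]_n}).

Definition dotv (x y : 'cV[R]_n) : R := (x^T *m y) 0 0.

Definition mx_op A : 'End('cV[R]_n) := linfun (mulmx A).

Lemma mx_opE A x : mx_op A x = A *m x. Proof. exact: lfunE. Qed.

Definition mx_ker A : {vspace 'cV[R]_n} := lker (mx_op A).

Definition orthonormal_basis k W (X : k.-tuple 'cV[R]_n) : Prop :=
  basis_of W X /\ (forall i j, dotv (tnth X i) (tnth X j) = (i == j)%:R).

Definition columns k (B : 'M[R]_(n, k)) : k.-tuple 'cV[R]_n :=
  [tuple col j B | j < k].

Definition invariant_subspace A W : Prop := (mx_op A @: W <= W)%VS.

Definition orthogonally_equivalent_on A W k (M : 'M[R]_k) : Prop :=
  M^T = M /\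
  exists2 X : k.-tuple 'cV[R]_n, orthonormal_basis W X
    & forall j, mx_op A (tnth X j) = \sum_i M i j *: tnth X i.

Definition orthogonal_mx A : Prop := A^T *m A = 1%:M.

End Operators.

Section Decomposition.
Variables (R : rcfType) (N : nat).

Definition sym_space : {vspace 'cV[R]_(N + (1 + N))} :=
  mx_ker (involution_mx R N - 1%:M).
Definition antisym_space : {vspace 'cV[R]_(N + (1 + N))} :=
  mx_ker (involution_mx R N + 1%:M).

Definition U_minus : 'M[R]_(N + (1 + N), N) :=
  col_mx (Num.sqrt 2)^-1%:M
    (col_mx 0
            (- (Num.sqrt 2)^-1%:M)).

Definition U_plus : 'M[R]_(N + (1 + N), 1 + N) :=
  col_mx (row_mx 0 (Num.sqrt 2)^-1%:M)
    (col_mx (row_mx 1%:M 0)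
            (row_mx 0 (Num.sqrt 2)^-1%:M)).

Definition M_sym (G : sgraph N) (S : {set 'I_N}) : 'M[R]_(1 + N) :=
  block_mx (2 * #|S|%:R)%:M              (- Num.sqrt 2 *: (loop_vec R S)^T)
           (- Num.sqrt 2 *: loop_vec R S) (loop_laplacian R G S).

End Decomposition.

(* Main.v *)
Require Import Defs.
From mathcomp Require Import all_boot all_order all_algebra.

Set Implicit Arguments.
Unset Strict Implicit.
Unset Printing Implicit Defensive.

Import Order.TTheory GRing.Theory Num.Theory.
Local Open Scope ring_scope.

(** Everything reduces to matrix identities between block matrices, along the
    splitting of the vertices of the lift into lower copy, middle vertex and
    upper copy.  In the lift, the lower vertex of i has one more neighbour
    than i has in G exactly when i carries a loop, namely the middle vertex, and
    likewise above; the middle vertex has 2|S| neighbours.  Hence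
    ([laplacian_lift]), with L_S the Laplacian of the self-loop graph and s the
    loop vector, the Laplacian of the lift is
<<
         (  L_S    -s       0  )
         ( -s^T   2|S|   -s^T  )
         (   0     -s     L_S  ).
>>
    A vector (x, a, y) is antisymmetric when y = - x and a = 0, and symmetric
    when y = x, so the two eigenspaces of the involution are the images of U_-
    and U_+ ([antisym_spaceP], [sym_spaceP]); these matrices satisfy
    U_-^T U_- = 1, U_+^T U_+ = 1 and U_-^T U_+ = 0, which makes (U_-, U_+)
    orthogonal.  Multiplying out the blocks gives the intertwining relations
    L U_- = U_- L_S and L U_+ = U_+ M_sym ([laplacian_lift_U_minus],
    [laplacian_lift_U_plus]): on antisymmetric vectors the two contributions
    to the middle vertex cancel, on symmetric ones they add up and
    2 / sqrt 2 = sqrt 2 produces the off-diagonal entries of M_sym.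

    The passage from these identities to subspaces and bases is general: if B
    has orthonormal columns, its image is W, and A B = B M, then the columns of
    B are an orthonormal basis of W, W is A-invariant, and A acts on W with
    matrix M in that basis. *)

(** * Adjacency in the lift *)

Lemma eq_set2 (T : finType) (u v a b : T) :
  ([set u; v] == [set a; b])
  = (u == a) && (v == b) || (u == b) && (v == a).
Proof.
apply/eqP/idP => [/setP e|/orP[]/andP[/eqP-> /eqP->] //]; last exact: setUC.
move: (e u) (e v) (e a) (e b); rewrite !inE !eqxx ?orbT /=.
rewrite ![a == _]eq_sym ![b == _]eq_sym.
by case: (u == a); case: (u == b); case: (v == a); case: (v == b).
Qed.

Variant lift_vertex_spec N : 'I_(N + (1 + N)) -> Type :=
  | LowerVertex i : lift_vertex_spec (lower i)
  | MiddleVertex : lift_vertex_spec (middle N)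
  | UpperVertex i : lift_vertex_spec (upper i).

Lemma lift_vertexP N (u : 'I_(N + (1 + N))) : lift_vertex_spec u.
Proof.
case: (split_ordP u) => [i|w] ->; first exact: LowerVertex.
case: (split_ordP w) => [k|i] ->; last exact: UpperVertex.
by rewrite (ord1 k); exact: MiddleVertex.
Qed.

Section LiftEdges.
Variables (N : nat) (G : sgraph N) (S : {set 'I_N}).

(** Together with [eq_set2], this reduces the comparison of two unordered pairs
    of vertices of the lift to comparisons of vertices of G. *)
Lemma lift_vertexE (i j : 'I_N) :
  ((lower i == lower j) = (i == j)) * ((upper i == upper j) = (i == j))
  * ((lower i == middle N) = false) * ((middle N == lower i) = false)
  * ((upper i == middle N) = false) * ((middle N == upper i) = false)
  * ((lower i == upper j) = false) * ((upper i == lower j) = false).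
Proof.
rewrite (inj_eq (@lower_inj N)) (inj_eq (@upper_inj N)).
rewrite ![_ == lower _]eq_sym ![_ == middle N]eq_sym.
rewrite (negPf (middle_neq_upper i)) [middle N == _]eq_sym.
by rewrite (negPf (lower_neq_middle i)) !eq_lrshift.
Qed.

Lemma exists_edge (i j : 'I_N) :
  [exists a, exists b, edge G a b &&
     ((i == a) && (j == b) || (i == b) && (j == a))] = edge G i j.
Proof.
apply/existsP/idP => [[a /existsP[b /andP[ab]]]|ij].
  by case/orP=> /andP[/eqP-> /eqP->] //; rewrite edge_sym.
by exists i; apply/existsP; exists j; rewrite ij !eqxx.
Qed.

Lemma exists_loop (i : 'I_N) : [exists a in S, i == a] = (i \in S).
Proof.
apply/existsP/idP => [[a /andP[aS /eqP->]] //|iS].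
by exists i; rewrite iS eqxx.
Qed.

Lemma no_edge (P : 'I_N -> 'I_N -> bool) : (forall a b, P a b = false) ->
  [exists a, exists b, P a b] = false.
Proof.
by move=> P0; apply/existsP => -[a /existsP[b]]; rewrite P0.
Qed.

Lemma no_loop (P : pred 'I_N) : (forall a, P a = false) ->
  [exists a in S, P a] = false.
Proof. by move=> P0; apply/existsP => -[a]; rewrite P0 andbF. Qed.

Lemma lift_edge_lower i j : lift_edge G S (lower i) (lower j) = edge G i j.
Proof.
rewrite /lift_edge no_loop; last first.
  by move=> a; rewrite !eq_set2 !lift_vertexE ?andbF.
rewrite orbF -exists_edge; apply: eq_existsb => a; apply: eq_existsb => b.
by rewrite !eq_set2 !lift_vertexE !orbF.
Qed.

Lemma lift_edge_upper i j : lift_edge G S (upper i) (upper j) = edge G i j.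
Proof.
rewrite /lift_edge no_loop; last first.
  by move=> a; rewrite !eq_set2 !lift_vertexE ?andbF.
rewrite orbF -exists_edge; apply: eq_existsb => a; apply: eq_existsb => b.
by rewrite !eq_set2 !lift_vertexE.
Qed.

Lemma lift_edge_lower_upper i j : lift_edge G S (lower i) (upper j) = false.
Proof.
rewrite /lift_edge no_loop; last first.
  by move=> a; rewrite !eq_set2 !lift_vertexE ?andbF.
by rewrite no_edge // => a b; rewrite !eq_set2 !lift_vertexE ?andbF.
Qed.

Lemma lift_edge_lower_middle i : lift_edge G S (lower i) (middle N) = (i \in S).
Proof.
rewrite /lift_edge no_edge; last first.
  by move=> a b; rewrite !eq_set2 !lift_vertexE ?andbF.
rewrite -exists_loop; apply: eq_existsb => a.
by rewrite !eq_set2 !lift_vertexE ?eqxx ?andbT ?orbF.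
Qed.

Lemma lift_edge_upper_middle i : lift_edge G S (upper i) (middle N) = (i \in S).
Proof.
rewrite /lift_edge no_edge; last first.
  by move=> a b; rewrite !eq_set2 !lift_vertexE ?andbF.
rewrite -exists_loop; apply: eq_existsb => a.
by rewrite !eq_set2 !lift_vertexE ?eqxx ?andbT.
Qed.

End LiftEdges.

(** * The Laplacian of the lift as a block matrix *)

Lemma laplacianE (R : pzRingType) n (H : sgraph n) i j :
  laplacian R H i j =
    (\sum_k (edge H i k)%:R) *+ (i == j) - (edge H i j)%:R.
Proof.
rewrite !mxE -sum1dep_card natr_sum big_mkcond /=.
by congr (_ *+ _ - _); apply: eq_bigr => k _; case: edge.
Qed.

Lemma loop_laplacianE (R : pzRingType) n (H : sgraph n) (S : {set 'I_n}) i j :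
  loop_laplacian R H S i j = laplacian R H i j + (i \in S)%:R *+ (i == j).
Proof. by rewrite mxE [X in _ + X]mxE !mxE. Qed.

Lemma loop_laplacian_sym (R : pzRingType) n (H : sgraph n) (S : {set 'I_n}) :
  (loop_laplacian R H S)^T = loop_laplacian R H S.
Proof.
apply/matrixP => i j; rewrite mxE !loop_laplacianE !laplacianE edge_sym.
by rewrite [j == i]eq_sym; case: eqP => [->|].
Qed.

(** The loop at i, which adds 1 to the diagonal of the Laplacian of G_S, is
    replaced in each copy by an edge to the middle vertex.  That edge adds the
    same 1 to the degree, so the two copies still carry the full self-loop
    Laplacian; its off-diagonal entries make up the borders - s. *)
Lemma laplacian_lift (R : pzRingType) N (G : sgraph N) (S : {set 'I_N}) :
  let s := loop_vec R S in let LS := loop_laplacian R G S in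
  laplacian R (acikmese_lift G S) =
    col_mx (row_mx LS (row_mx (- s) 0))
   (col_mx (row_mx (- s^T) (row_mx (#|S|%:R *+ 2)%:M (- s^T)))
           (row_mx 0 (row_mx (- s) LS))).
Proof.
move=> s LS.
have sumE (F : 'I_(N + (1 + N)) -> R) : \sum_u F u
    = \sum_i F (lower i) + (F (middle N) + \sum_i F (upper i)).
  by rewrite big_split_ord big_split_ord big_ord1.
have cardS : \sum_i (i \in S)%:R = #|S|%:R :> R.
  rewrite -natr_sum -sum1_card [in RHS]big_mkcond.
  by congr _%:R; apply: eq_bigr => i _; case: (i \in S).
have degL i : \sum_u (lift_edge G S (lower i) u)%:R
    = \sum_j (edge G i j)%:R + (i \in S)%:R :> R.
  rewrite sumE lift_edge_lower_middle; congr (_ + _).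
    by apply: eq_bigr => j _; rewrite lift_edge_lower.
  by rewrite big1 ?addr0 // => j _; rewrite lift_edge_lower_upper.
have degU i : \sum_u (lift_edge G S (upper i) u)%:R
    = \sum_j (edge G i j)%:R + (i \in S)%:R :> R.
  rewrite sumE lift_edge_upper_middle big1 => [|j _]; last first.
    by rewrite lift_edge_sym lift_edge_lower_upper.
  rewrite add0r addrC; congr (_ + _).
  by apply: eq_bigr => j _; rewrite lift_edge_upper.
have degM : \sum_u (lift_edge G S (middle N) u)%:R = #|S|%:R *+ 2 :> R.
  rewrite sumE lift_edge_irr add0r mulr2n -cardS.
  congr (_ + _); apply: eq_bigr => j _; rewrite lift_edge_sym.
    by rewrite lift_edge_lower_middle.
  by rewrite lift_edge_upper_middle.
apply/matrixP => u v; rewrite laplacianE /=.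
case: u / (lift_vertexP u) => [i||i]; case: v / (lift_vertexP v) => [j||j].
- rewrite degL lift_edge_lower (inj_eq (@lower_inj N)).
  rewrite col_mxEu row_mxEl loop_laplacianE laplacianE.
  by rewrite addrAC mulrnDl.
- rewrite lift_edge_lower_middle (negPf (lower_neq_middle i)).
  rewrite col_mxEu row_mxEr row_mxEl.
  by rewrite !mxE sub0r.
- rewrite lift_edge_lower_upper eq_lrshift col_mxEu !row_mxEr.
  by rewrite mxE subr0.
- rewrite lift_edge_sym lift_edge_lower_middle eq_sym.
  rewrite (negPf (lower_neq_middle j)).
  rewrite col_mxEd col_mxEu row_mxEl.
  by rewrite !mxE sub0r.
- rewrite degM lift_edge_irr eqxx col_mxEd col_mxEu row_mxEr row_mxEl.
  by rewrite !mxE subr0.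
- rewrite lift_edge_sym lift_edge_upper_middle.
  rewrite (negPf (middle_neq_upper j)) col_mxEd col_mxEu !row_mxEr.
  by rewrite !mxE sub0r.
- rewrite lift_edge_sym lift_edge_lower_upper eq_sym eq_lrshift.
  by rewrite !col_mxEd row_mxEl mxE subr0.
- rewrite lift_edge_upper_middle eq_sym (negPf (middle_neq_upper i)).
  rewrite !col_mxEd row_mxEr row_mxEl.
  by rewrite !mxE sub0r.
- rewrite degU lift_edge_upper (inj_eq (@upper_inj N)).
  rewrite !col_mxEd !row_mxEr loop_laplacianE laplacianE.
  by rewrite addrAC mulrnDl.
Qed.

(** * Orthonormal frames of invariant subspaces *)

Section OrthonormalFrame.
Variables (R : fieldType) (n k : nat) (B : 'M[R]_(n, k)).
Variable W : {vspace 'cV[R]_n}.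
Hypothesis BB : B^T *m B = 1%:M.
Hypothesis imB : forall x, reflect (exists y, x = B *m y) (x \in W).

Lemma mulmx_columns (y : 'cV[R]_k) :
  B *m y = \sum_j y j 0 *: tnth (columns B) j.
Proof.
apply/colP => i; rewrite summxE mxE; apply: eq_bigr => j _.
by rewrite tnth_mktuple !mxE mulrC.
Qed.

Lemma columns_orthonormal : orthonormal_basis W (columns B).
Proof.
split; last first.
  move=> i j; rewrite !tnth_mktuple /dotv.
  have /matrixP/(_ i j) := BB; rewrite [RHS]mxE => <-.
  by rewrite !mxE; apply: eq_bigr => l _; rewrite !mxE.
rewrite basisEfree; apply/and3P; split.
(* B^T is a left inverse of B, so B c = 0 forces c = 0. *)
- apply/freeP => c c0.
  suff /colP y0 : \col_j c j = 0 :> 'cV[R]_k.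
    by move=> j; have := y0 j; rewrite !mxE.
  rewrite -[LHS]mul1mx -BB -mulmxA mulmx_columns -[RHS](mulmx0 _ B^T).
  congr mulmx; rewrite -[RHS]c0; apply: eq_bigr => j _.
  by rewrite mxE (tnth_nth 0).
- apply/span_subvP => _ /tnthP[j ->]; rewrite tnth_mktuple; apply/imB.
  by exists (delta_mx j 0); rewrite colE.
- have subW : (W <= <<columns B>>)%VS.
    apply/subvP => _ /imB[y ->]; rewrite mulmx_columns.
    by apply: memv_suml => j _; rewrite memvZ ?memv_span ?mem_tnth.
  exact: leq_trans (dimvS subW) (dim_span _).
Qed.

Variables (A : 'M[R]_n) (M : 'M[R]_k).
Hypothesis AB : A *m B = B *m M.

(** A maps B y to B (M y), which is again in the image W of B. *)
Lemma frame_invariant : invariant_subspace A W.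
Proof.
apply/subvP => _ /memv_imgP[x /imB[y ->] ->].
by rewrite mx_opE; apply/imB; exists (M *m y); rewrite !mulmxA AB.
Qed.

(** The j-th column of A B = B M expands A on the j-th basis vector with the
    coefficients of the j-th column of M. *)
Lemma frame_equivalent : M^T = M -> orthogonally_equivalent_on A W M.
Proof.
move=> MT; split=> //; exists (columns B); first exact: columns_orthonormal.
move=> j; rewrite mx_opE tnth_mktuple colE mulmxA AB -mulmxA -colE.
by rewrite mulmx_columns; apply: eq_bigr => i _; rewrite mxE.
Qed.

End OrthonormalFrame.

(** * Symmetric and antisymmetric vectors *)

Section Decomposition.
Variables (R : rcfType) (N : nat).
Let r2 : R := Num.sqrt 2.

Lemma sqrt2V_sqrt2 : r2^-1 * r2 = 1.
Proof. by rewrite mulVf // sqrtr_eq0 -ltNge ltr0n. Qed.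

Lemma sqr_sqrt2V : r2^-1 * r2^-1 *+ 2 = 1.
Proof.
rewrite -mulr_natr -[2%:R](@sqr_sqrtr R) ?ler0n // expr2 mulrACA.
by rewrite sqrt2V_sqrt2 mulr1.
Qed.

Lemma sqrt2V_double : r2^-1 *+ 2 = r2.
Proof.
by rewrite -[RHS]mul1r -sqr_sqrt2V mulrnAl -mulrA sqrt2V_sqrt2 mulr1.
Qed.

Lemma U_minusK : (U_minus R N)^T *m U_minus R N = 1%:M.
Proof.
rewrite /U_minus -/r2 !tr_col_mx !mul_row_col !linearN /= trmx0 !tr_scalar_mx.
rewrite mul0mx add0r mulNmx opprK -mulr2n -scalar_mxM -raddfMn /=.
by rewrite sqr_sqrt2V.
Qed.

Lemma U_plusK : (U_plus R N)^T *m U_plus R N = 1%:M.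
Proof.
rewrite /U_plus -/r2 !tr_col_mx !tr_row_mx !mul_row_col !mul_col_row.
rewrite !trmx0 !tr_scalar_mx !(mul0mx, mulmx0) mul1mx !add_block_mx.
rewrite !(add0r, addr0) -mulr2n -scalar_mxM -raddfMn /= sqr_sqrt2V.
by rewrite -scalar_mx_block.
Qed.

Lemma U_minus_plus : (U_minus R N)^T *m U_plus R N = 0.
Proof.
rewrite /U_minus /U_plus -/r2 !tr_col_mx !mul_row_col !linearN /= trmx0.
by rewrite mul0mx add0r mulNmx subrr.
Qed.

Lemma U_orthogonal : orthogonal_mx (row_mx (U_minus R N) (U_plus R N)).
Proof.
rewrite /orthogonal_mx tr_row_mx mul_col_row U_minusK U_plusK U_minus_plus.
have -> : (U_plus R N)^T *m U_minus R N = 0.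
  by rewrite -[LHS]trmxK trmx_mul trmxK U_minus_plus trmx0.
by rewrite -scalar_mx_block.
Qed.

(** The middle coordinate a satisfies a = - a, so it vanishes because 2 is
    invertible; the lower part x then determines the vector, which is the image
    of sqrt 2 x. *)
Lemma antisym_spaceP x :
  reflect (exists y, x = U_minus R N *m y) (x \in antisym_space R N).
Proof.
have mulE y : U_minus R N *m y
    = col_mx (r2^-1 *: y) (col_mx 0 (- (r2^-1 *: y))).
  by rewrite /U_minus -/r2 !mul_col_mx mul0mx mulNmx mul_scalar_mx.
rewrite memv_ker mx_opE mulmxDl mul1mx.
apply: (iffP eqP) => [|[y ->]]; last first.
  rewrite mulE involution_mxE !add_col_mx addNr subrr addr0.
  by rewrite !col_mx0.
rewrite -[x]vsubmxK; set xL := usubmx x; rewrite -[dsubmx x]vsubmxK.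
set a := usubmx _; set xU := dsubmx _; rewrite involution_mxE !add_col_mx.
rewrite -[0]col_mx0 => /eq_col_mx[eUL]; rewrite -[0]col_mx0 => /eq_col_mx[ea _].
exists (r2 *: xL); rewrite mulE scalerA sqrt2V_sqrt2 scale1r.
have -> : a = 0.
  apply/colP => i; have /colP/(_ i) := ea; rewrite !mxE => /eqP.
  by rewrite -mulr2n mulrn_eq0 => /eqP.
by rewrite -(addr0_eq eUL) opprK.
Qed.

(** The middle coordinate a is free and the upper part repeats the lower part
    x, so the vector is the image of (a, sqrt 2 x). *)
Lemma sym_spaceP x :
  reflect (exists y, x = U_plus R N *m y) (x \in sym_space R N).
Proof.
have mulE a y : U_plus R N *m col_mx a y
    = col_mx (r2^-1 *: y) (col_mx a (r2^-1 *: y)).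
  rewrite /U_plus -/r2 !mul_col_mx !mul_row_col !mul0mx mul1mx mul_scalar_mx.
  by rewrite addr0 !add0r.
rewrite memv_ker mx_opE mulmxBl mul1mx subr_eq0.
apply: (iffP eqP) => [|[y ->]]; last first.
  by rewrite -[y]vsubmxK mulE involution_mxE.
rewrite -[x]vsubmxK; set xL := usubmx x; rewrite -[dsubmx x]vsubmxK.
set a := usubmx _; set xU := dsubmx _; rewrite involution_mxE.
move=> /eq_col_mx[-> _].
by exists (col_mx a (r2 *: xL)); rewrite mulE scalerA sqrt2V_sqrt2 scale1r.
Qed.

(** * Intertwining relations *)

Variables (G : sgraph N) (S : {set 'I_N}).
Let s := loop_vec R S.
Let LS := loop_laplacian R G S.

(** The middle row gives - s^T + s^T = 0, and the middle column meets the zero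
    block of U_-, so s drops out and each copy sees only L_S. *)
Lemma laplacian_lift_U_minus :
  laplacian R (acikmese_lift G S) *m U_minus R N = U_minus R N *m LS.
Proof.
rewrite laplacian_lift /U_minus -/r2 !mul_col_mx !mul_row_col.
rewrite !(mul0mx, mulmx0, mulmxN, mulNmx, add0r, addr0, oppr0) opprK addNr.
by rewrite !scalar_mxC.
Qed.

(** The middle row now gives - (2 / sqrt 2) s^T = - sqrt 2 s^T, while the middle
    column - s becomes - sqrt 2 s after the normalisation 1 / sqrt 2 of the
    columns of U_+ is factored out. *)
Lemma laplacian_lift_U_plus :
  laplacian R (acikmese_lift G S) *m U_plus R N = U_plus R N *m M_sym R G S.
Proof.
rewrite laplacian_lift /U_plus -/r2 /M_sym /block_mx !mul_col_mx !mul_row_col.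
rewrite !mul_mx_row !add_row_mx.
rewrite !(mul0mx, mulmx0, mul1mx, mulmx1, mulNmx, add0r, addr0, oppr0).
rewrite -/s -/LS -/r2 !mul_mx_scalar !mul_scalar_mx scalerA mulrN sqrt2V_sqrt2.
by rewrite scaleN1r -opprD -mulr2n scalerMnl sqrt2V_double scaleNr mulr_natl.
Qed.

Lemma M_sym_sym : (M_sym R G S)^T = M_sym R G S.
Proof.
rewrite /M_sym tr_block_mx tr_scalar_mx !linearZ /= trmxK.
by rewrite loop_laplacian_sym.
Qed.

End Decomposition.

Theorem theorem3p5 (R : rcfType) (N : nat) (G : sgraph N) (S : {set 'I_N})
    (S_gt0 : (1 <= #|S|)%N) :
  let L := laplacian R (acikmese_lift G S) in
  [/\ orthogonal_mx (row_mx (U_minus R N) (U_plus R N)),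
      orthonormal_basis (antisym_space R N) (columns (U_minus R N))
    & orthonormal_basis (sym_space R N) (columns (U_plus R N))]
  /\
  [/\ invariant_subspace L (antisym_space R N),
      invariant_subspace L (sym_space R N),
      orthogonally_equivalent_on L (antisym_space R N) (loop_laplacian R G S),
      orthogonally_equivalent_on L (sym_space R N) (M_sym R G S)
    & mxsub (@rshift 1 N) (@rshift 1 N) (M_sym R G S) = loop_laplacian R G S].
Proof.
have Km := U_minusK R N; have Kp := U_plusK R N.
have Wm := @antisym_spaceP R N; have Wp := @sym_spaceP R N.
have Lm := laplacian_lift_U_minus R G S; have Lp := laplacian_lift_U_plus R G S.
move=> L; split; split.
- exact: U_orthogonal.
- exact: columns_orthonormal.
- exact: columns_orthonormal.
- exact: (frame_invariant Wm Lm).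
- exact: (frame_invariant Wp Lp).
- exact: (frame_equivalent Km Wm Lm) (loop_laplacian_sym R G S).
- exact: (frame_equivalent Kp Wp Lp) (M_sym_sym R G S).
- by apply/matrixP => i j; rewrite mxE block_mxEdr.
Qed.
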